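(* For every positive integer $n$, $$a(n)=\frac{\sigma(n)-\lambda(n)}{4}-\frac{\sigma(n/2)}{2}+\sigma(n/4),$$ where, by convention, $\sigma(x)=0$ whenever $x$ is not a positive integer.
   Context: For a positive integer $n$, $a(n)$ is the signed number of partitions of $n$ into exactly two distinct part sizes, each occurring an odd number of times: $$a(n)=\sum (-1)^{r_1+r_2},$$ the sum being over all quadruples of integers $(x,y,r_1,r_2)$ with $1\le x<y$, $r_1,r_2\ge 0$ and $(2r_1+1)x+(2r_2+1)y=n$. Equivalently, $\sum_{n\ge1}a(n)q^n=\sum_{1\le n_1<n_2}\frac{q^{n_1}}{1+q^{2n_1}}\cdot\frac{q^{n_2}}{1+q^{2n_2}}$. $\chi_4$ is the Dirichlet character modulo $4$: $\chi_4(n)=1$ if $n\equiv1\pmod 4$, $\chi_4(n)=-1$ if $n\equiv -1\pmod 4$, and $\chi_4(n)=0$ if $n$ is even. For a positive integer $n$, $\lambda(n)=\sum_{d\mid n}\chi_4(d)$ and $\sigma(n)=\sum_{d\mid n}d$ (sums over positive divisors). *)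

(* Defs.v *)
From mathcomp Require Import all_boot all_order all_algebra.
From mathcomp Require Import zify.

Set Implicit Arguments.
Unset Strict Implicit.
Unset Printing Implicit Defensive.

Import Order.TTheory GRing.Theory Num.Theory.
Local Open Scope ring_scope.

Definition admissible (n x y r1 r2 : nat) : bool :=
  [&& 1 <= x, x < y & (2 * r1 + 1) * x + (2 * r2 + 1) * y == n]%N.

(* Hence restricting x, y, r1, r2 to 'I_n.+1 in [a] below loses no quadruple. *)
Lemma admissible_bound (n x y r1 r2 : nat) :
  admissible n x y r1 r2 -> [&& x <= n, y <= n, r1 <= n & r2 <= n]%N.
Proof. by rewrite /admissible => /and3P[x1 xy /eqP eqn]; apply/and4P; split; nia. Qed.

Definition a (n : nat) : int :=
  \sum_(x < n.+1) \sum_(y < n.+1) \sum_(r1 < n.+1)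
    \sum_(r2 < n.+1 | admissible n x y r1 r2) (-1) ^+ (r1 + r2).

Definition chi4 (n : nat) : int :=
  if (n %% 4 == 1)%N then 1 else if (n %% 4 == 3)%N then -1 else 0.

Definition lambda (n : nat) : int := \sum_(d <- divisors n) chi4 d.

(* The argument is rational so that sigma (n / 2) and sigma (n / 4) make sense
   for every n; sigma 0 = 0 because divisors 0 = [::]. *)
Definition sigma (x : rat) : rat :=
  if x \is a Num.nat then \sum_(d <- divisors (Num.truncn x)) d%:R else 0.

Lemma sigma_nat (n : nat) : sigma n%:R = \sum_(d <- divisors n) d%:R.
Proof. by rewrite /sigma natr_nat natrK. Qed.

(* Main.v *)
Require Import Defs.
From mathcomp Require Import all_boot all_order all_algebra.
From mathcomp Require Import zify ring lra.

Set Implicit Arguments.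
Unset Strict Implicit.
Unset Printing Implicit Defensive.

Import Order.TTheory GRing.Theory Num.Theory.
Local Open Scope ring_scope.

(* Write A(q) for the generating function of a.  Twice A is the square of
   sum_n lambda(n) q^n minus its diagonal, that is, a sum of chi4(u) chi4(v)
   over u x + v y = n, with x = y removed.  With f(k) = cos(pi k / 2),
   2 chi4(u) chi4(v) = f(u - v) - f(u + v), so the full sum is an instance of
   Liouville's identity for even functions, which follows from the
   substitutions (a + b) x + b y = a x + b (x + y) on the solutions of
   a x + b y = n.  The divisor sums that remain only involve f on multiples of
   2 and 4. *)

(** * Reindexing of finite sums *)

(** The maps need to be mutually inverse only on the filtered lists, so [h] and [k] may use
    truncated subtraction, integer division or [inord]. *)
Lemma sum_seq_bij (R : nmodType) (A B : eqType) (s : seq A) (t : seq B)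
    (P : pred A) (Q : pred B) (h : A -> B) (k : B -> A) (F : A -> R) (G : B -> R) :
  uniq s -> uniq t ->
  (forall u, u \in s -> P u -> [/\ h u \in t, Q (h u), k (h u) = u & F u = G (h u)]) ->
  (forall v, v \in t -> Q v -> [/\ k v \in s, P (k v) & h (k v) = v]) ->
  \sum_(u <- s | P u) F u = \sum_(v <- t | Q v) G v.
Proof.
move=> us ut hP kQ; rewrite -[LHS]big_filter -[RHS]big_filter.
have st : perm_eq [seq v <- t | Q v] (map h [seq u <- s | P u]).
  apply: uniq_perm; first exact: filter_uniq.
    rewrite map_inj_in_uniq ?filter_uniq // => u1 u2.
    rewrite !mem_filter => /andP[P1 s1] /andP[P2 s2] e12.
    by have [_ _ <- _] := hP _ s1 P1; have [_ _ <- _] := hP _ s2 P2; rewrite e12.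
  move=> v; apply/idP/mapP.
    rewrite mem_filter => /andP[Qv tv]; have [ks kP hk] := kQ _ tv Qv.
    by exists (k v); rewrite ?mem_filter ?ks ?kP.
  case=> u; rewrite mem_filter => /andP[Pu su] ->.
  by have [ht Qh _ _] := hP _ su Pu; rewrite mem_filter ht Qh.
rewrite (perm_big _ st) big_map big_seq [RHS]big_seq.
by apply: eq_bigr => u; rewrite mem_filter => /andP[Pu su]; have [] := hP _ su Pu.
Qed.

Lemma mem_allpairs_pair (A B : eqType) (s : seq A) (t : seq B) u v :
  ((u, v) \in [seq (x, y) | x <- s, y <- t]) = (u \in s) && (v \in t).
Proof.
apply/allpairsP/andP => [[[x y] /= [xs yt [-> ->]]]|[us vt]] //.
by exists (u, v).
Qed.

(** * Positive solutions of a x + b y = n *)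

(** An entry is read as (a, x, (b, y)). The range 1..n loses no positive solution, because each
    unknown is at most a x + b y = n. *)
Definition sols (n : nat) : seq (nat * nat * (nat * nat)) :=
  let pairs := [seq (i, j) | i <- iota 1 n, j <- iota 1 n] in
  [seq q <- [seq (p, r) | p <- pairs, r <- pairs] |
    q.1.1 * q.1.2 + q.2.1 * q.2.2 == n]%N.

Lemma sols_uniq n : uniq (sols n).
Proof.
by apply/filter_uniq/allpairs_uniq; [| |by move=> [? ?] [? ?]];
  apply: allpairs_uniq; rewrite ?iota_uniq // => -[? ?] [? ?].
Qed.

Lemma mem_sols n a x b y : (a, x, (b, y)) \in sols n =
  [&& 0 < a, 0 < x, 0 < b, 0 < y & a * x + b * y == n]%N.
Proof.
rewrite mem_filter /= !(mem_allpairs_pair, mem_iota).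
apply/idP/idP; first by case/and3P => ? /andP[? ?] /andP[? ?]; lia.
by case/and5P=> ? ? ? ? /eqP e; rewrite e eqxx; nia.
Qed.

Section SolutionSums.
Variables (R : nmodType) (n : nat).
Implicit Types (F : nat * nat * (nat * nat) -> R) (f : nat -> R).

Lemma sols_trichotomy (i j : nat * nat * (nat * nat) -> nat) F :
  \sum_(q <- sols n) F q =
    \sum_(q <- sols n | (i q < j q)%N) F q +
    (\sum_(q <- sols n | i q == j q) F q + \sum_(q <- sols n | (j q < i q)%N) F q).
Proof.
rewrite (bigID (fun q => (i q < j q)%N)) /=; congr (_ + _).
rewrite (bigID (fun q => i q == j q)) /=.
by congr (_ + _); apply: eq_bigl => q; lia.
Qed.

Lemma sols_swap (P : pred (nat * nat * (nat * nat))) F :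
  \sum_(q <- sols n | P q) F q = \sum_(q <- sols n | P (q.2, q.1)) F (q.2, q.1).
Proof.
apply: (sum_seq_bij (h := fun q => (q.2, q.1)) (k := fun q => (q.2, q.1)));
  rewrite ?sols_uniq // => -[[a x] [b y]] /=; rewrite !mem_sols;
  by case/and5P=> *; split=> //; lia.
Qed.

(** Since a x + b y = (a - b) x + b (x + y), the region b < a corresponds to the region x < y. *)
Lemma sols_sum_distn f :
  \sum_(q <- sols n | (q.2.1 < q.1.1)%N) f `|q.1.1 - q.2.1|%N =
  \sum_(q <- sols n | (q.1.2 < q.2.2)%N) f q.1.1.
Proof.
apply: (sum_seq_bij (h := fun q => (q.1.1 - q.2.1, q.1.2, (q.2.1, q.1.2 + q.2.2))%N)
          (k := fun q => (q.1.1 + q.2.1, q.1.2, (q.2.1, q.2.2 - q.1.2))%N));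
  rewrite ?sols_uniq // => -[[a x] [b y]] /=; rewrite !mem_sols.
  case/and5P=> ? ? ? ? /eqP <- ltba; split; [nia | lia | | by congr f; lia].
  by congr (_, _, (_, _)); lia.
case/and5P=> ? ? ? ? /eqP <- ltxy; split; [nia | lia | ].
by congr (_, _, (_, _)); lia.
Qed.

(** Since a x + b y = (a + b) y + a (x - y), the region y < x corresponds to the one where the first
    coefficient exceeds the second. *)
Lemma sols_sum_addn f :
  \sum_(q <- sols n | (q.2.2 < q.1.2)%N) f (q.1.1 + q.2.1)%N =
  \sum_(q <- sols n | (q.2.1 < q.1.1)%N) f q.1.1.
Proof.
apply: (sum_seq_bij (h := fun q => (q.1.1 + q.2.1, q.2.2, (q.1.1, q.1.2 - q.2.2))%N)
          (k := fun q => (q.2.1, q.2.2 + q.1.2, (q.1.1 - q.2.1, q.1.2))%N));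
  rewrite ?sols_uniq // => -[[a x] [b y]] /=; rewrite !mem_sols.
  case/and5P=> ? ? ? ? /eqP <- ltyx; split; [nia | lia | | by []].
  by congr (_, _, (_, _)); lia.
case/and5P=> ? ? ? ? /eqP <- ltba; split; [nia | lia | ].
by congr (_, _, (_, _)); lia.
Qed.

(** Here a x + b y = a (x - y) + (a + b) y, which keeps the coefficient a fixed. *)
Lemma sols_sum_transfer f :
  \sum_(q <- sols n | (q.2.2 < q.1.2)%N) f q.1.1 =
  \sum_(q <- sols n | (q.1.1 < q.2.1)%N) f q.1.1.
Proof.
apply: (sum_seq_bij (h := fun q => (q.1.1, q.1.2 - q.2.2, (q.1.1 + q.2.1, q.2.2))%N)
          (k := fun q => (q.1.1, q.1.2 + q.2.2, (q.2.1 - q.1.1, q.2.2))%N));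
  rewrite ?sols_uniq // => -[[a x] [b y]] /=; rewrite !mem_sols.
  case/and5P=> ? ? ? ? /eqP <- ltyx; split; [nia | lia | | by []].
  by congr (_, _, (_, _)); lia.
case/and5P=> ? ? ? ? /eqP <- ltab; split; [nia | lia | ].
by congr (_, _, (_, _)); lia.
Qed.

Hypothesis n_gt0 : (0 < n)%N.

Lemma uniq_divisor_pairs (r : nat -> nat) :
  uniq [seq (d, u) | d <- divisors n, u <- iota 1 (r d)].
Proof.
apply: allpairs_uniq_dep; first exact: divisors_uniq.
  by move=> d _; apply: iota_uniq.
by move=> [d u] [d' u'] _ _ /= [-> ->].
Qed.

Lemma mem_divisor_pairs (r : nat -> nat) d u :
  (d, u) \in [seq (d, u) | d <- divisors n, u <- iota 1 (r d)] =
  [&& d %| n, 0 < u & u <= r d]%N.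
Proof.
apply/allpairsPdep/idP => [[d' [u' [dn ur [-> ->]]]]|/and3P[dn u0 ur]].
  by move: dn ur; rewrite -dvdn_divisors // mem_iota => -> /=; lia.
by exists d, u; rewrite -dvdn_divisors // mem_iota; split=> //; lia.
Qed.

(** If a = b = d, then d (x + y) = n, so d divides n and x runs over 1, ..., n/d - 1. *)
Lemma sols_sum_eq_values (g : nat -> R) :
  \sum_(q <- sols n | q.1.1 == q.2.1) g q.1.1 =
  \sum_(d <- divisors n) g d *+ (n %/ d).-1.
Proof.
pose s := [seq (d, u) | d <- divisors n, u <- iota 1 (n %/ d).-1].
transitivity (\sum_(p <- s) g p.1); last first.
  rewrite big_allpairs_dep; apply: eq_bigr => d _.
  by rewrite /= big_const_seq count_predT size_iota iter_addr_0.
apply: (sum_seq_bij (h := fun q => (q.1.1, q.1.2))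
          (k := fun p => (p.1, p.2, (p.1, n %/ p.1 - p.2))%N));
  rewrite ?sols_uniq ?uniq_divisor_pairs //.
  move=> [[a x] [b y]] /=; rewrite mem_sols mem_divisor_pairs.
  case/and5P=> a0 x0 _ y0 /eqP en /eqP eab; subst b.
  have -> : n = ((x + y) * a)%N by lia.
  rewrite dvdn_mull // mulnK //; split=> //; first by lia.
  by congr (_, _, (_, _)); lia.
move=> [d u]; rewrite mem_divisor_pairs mem_sols /= => /and3P[dn u0 ur] _; split=> //.
by have := divnK dn; move: (n %/ d)%N ur n_gt0 => k ? ? ?; nia.
Qed.

(** If x = y, then d = a + b divides n, and a = u runs over 1, ..., d - 1. *)
Lemma sols_sum_eq_factors (G : nat -> nat -> R) :
  \sum_(q <- sols n | q.1.2 == q.2.2) G q.1.1 q.2.1 =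
  \sum_(d <- divisors n) \sum_(1 <= u < d) G u (d - u)%N.
Proof.
pose s := [seq (d, u) | d <- divisors n, u <- iota 1 d.-1].
transitivity (\sum_(p <- s) G p.2 (p.1 - p.2)%N); last first.
  rewrite big_allpairs_dep; apply: eq_bigr => d _.
  by rewrite /index_iota subn1.
apply: (sum_seq_bij (h := fun q => (q.1.1 + q.2.1, q.1.1)%N)
          (k := fun p => (p.2, n %/ p.1, (p.1 - p.2, n %/ p.1))%N));
  rewrite ?sols_uniq ?uniq_divisor_pairs //.
  move=> [[a x] [b y]] /=; rewrite mem_sols mem_divisor_pairs.
  case/and5P=> a0 x0 b0 _ /eqP en /eqP exy; subst y.
  have -> : n = (x * (a + b))%N by lia.
  rewrite dvdn_mull // mulnK; last by lia.
  by rewrite addKn; split=> //; lia.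
move=> [d u]; rewrite mem_divisor_pairs mem_sols /= eqxx => /and3P[dn u0 ur] _.
split=> //; last by congr (_, _); lia.
by have := divnK dn; move: (n %/ d)%N ur n_gt0 => k ? ? ?; nia.
Qed.

End SolutionSums.

(** * Liouville's identity for even functions *)

(** The terms f(|a - b|) are split by comparing a with b, the terms f(a + b) by comparing x with y.
    Up to the diagonals this leaves 2 (X - Y), where X and Y sum f(a) over x < y and over b < a. *)
Lemma Liouville_identity (R : comNzRingType) (f : nat -> R) (n : nat) :
  (0 < n)%N ->
  \sum_(q <- sols n) (f `|q.1.1 - q.2.1|%N - f (q.1.1 + q.2.1)%N) =
  \sum_(d <- divisors n)
    (f 0%N *+ (n %/ d).-1 + f d *+ (n %/ d).-1 *+ 2 - f d *+ d.-1
     - (\sum_(1 <= c < d) f c) *+ 2).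
Proof.
move=> n_gt0; rewrite sumrB.
rewrite (sols_trichotomy n (fun q => q.1.1) (fun q => q.2.1)).
rewrite [X in _ - X](sols_trichotomy n (fun q => q.1.2) (fun q => q.2.2)) /=.
rewrite [X in X + _ - _]sols_swap [X in _ - (X + _)]sols_swap /=.
under [X in X + _ - _]eq_bigr => q _ do rewrite distnC.
under [X in _ - (X + _)]eq_bigr => q _ do rewrite addnC.
rewrite sols_sum_distn sols_sum_addn.
have -> : \sum_(q <- sols n | q.1.1 == q.2.1) f `|q.1.1 - q.2.1|%N =
          \sum_(d <- divisors n) f 0%N *+ (n %/ d).-1.
  rewrite -(sols_sum_eq_values n_gt0 (fun=> f 0%N)).
  by apply: eq_bigr => q /eqP->; rewrite distnn.
rewrite (sols_sum_eq_factors n_gt0 (fun a b => f (a + b)%N)).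
have -> : \sum_(d <- divisors n) \sum_(1 <= u < d) f (u + (d - u))%N =
          \sum_(d <- divisors n) f d *+ d.-1.
  apply: eq_bigr => d _; rewrite -subn1 -sumr_const_nat.
  by apply: eq_big_nat => u ?; congr f; lia.
(* Splitting the sum of f(a) in both ways gives X + S + Z = Z + V + Y, hence X - Y = V - S. *)
have := sols_trichotomy n (fun q => q.1.1) (fun q => q.2.1) (fun q => f q.1.1).
rewrite (sols_trichotomy n (fun q => q.1.2) (fun q => q.2.2) (fun q => f q.1.1)).
rewrite sols_sum_transfer (sols_sum_eq_values n_gt0) /=.
rewrite (sols_sum_eq_factors n_gt0 (fun a _ => f a)).
rewrite !(sumrB, big_split) /=.
set X := \sum_(q <- sols n | (q.1.2 < q.2.2)%N) _.
set Y := \sum_(q <- sols n | (q.2.1 < q.1.1)%N) _.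
set Z := \sum_(q <- sols n | (q.1.1 < q.2.1)%N) _.
set S := \sum_(d <- _) \sum_(1 <= u < d) _.
set V := \sum_(d <- _) f d *+ (n %/ d).-1 => e.
have -> : X = Y + V - S by move/(canRL (addrK _)): e => ->; ring.
ring.
Qed.

(** * The function cos (pi k / 2) *)

(** Indicators of divisibility, rather than cases modulo 4, let the final divisor sum be read as
    values of [sigma] at n / 4 and n / 2. *)
Definition cos4 (k : nat) : int := (4 %| k)%N%:R *+ 2 - (2 %| k)%N%:R.

Lemma divn4_eq (k : nat) : exists m r, (k = r + 4 * m /\ r < 4)%N.
Proof. by exists (k %/ 4)%N, (k %% 4)%N; lia. Qed.

Lemma cos4E k : cos4 k = if (k %% 4 == 0)%N then 1 else if (k %% 4 == 2)%N then -1 else 0.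
Proof.
rewrite /cos4; have : (k %% 4 < 4)%N by rewrite ltn_mod.
have -> : (4 %| k)%N = (k %% 4 == 0)%N by [].
have -> : (2 %| k)%N = ((k %% 4) %% 2 == 0)%N by lia.
by case: (k %% 4)%N => [|[|[|[|]]]].
Qed.

(** As chi4(u) = sin(pi u / 2), this is the product-to-sum formula; it is checked on residues modulo
    4. *)
Lemma chi4M_cos4 u v :
  (chi4 u * chi4 v) *+ 2 = cos4 `|u - v|%N - cos4 (u + v)%N.
Proof.
have [j [r [eu ltr]]] := divn4_eq u; have [k [s [ev lts]]] := divn4_eq v.
have Eu : (u %% 4 = r)%N by lia.
have Ev : (v %% 4 = s)%N by lia.
have Ep : ((u + v) %% 4 = (r + s) %% 4)%N by lia.
(* The sign of u - v is unknown, so the distance is r - s or s - r modulo 4; the added 4 prevents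
   truncation. *)
have Em : (`|u - v| %% 4 = (r + 4 - s) %% 4 \/ `|u - v| %% 4 = (s + 4 - r) %% 4)%N by lia.
rewrite !cos4E /chi4 Eu Ev Ep; move: r s ltr lts Em {Eu Ev Ep eu ev}.
by do 4?[case=> //]; do 4?[case=> //]; move=> _ _ [] ->.
Qed.

(** By induction on d: the shifts chi4(d + 1) = cos4(d) and cos4(d + 1) = -chi4(d) make the right
    side grow by 2 cos4(d). *)
Lemma sum_cos4 d : (0 < d)%N ->
  (\sum_(1 <= c < d) cos4 c) *+ 2 = chi4 d - cos4 d - 1.
Proof.
case: d => // d _; elim: d => [|d IHd]; first by rewrite big_geq.
rewrite big_nat_recr //= mulrnDl IHd !cos4E /chi4.
have /or4P[] : [|| d.+1 %% 4 == 0, d.+1 %% 4 == 1, d.+1 %% 4 == 2 | d.+1 %% 4 == 3]%N by lia.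
all: move=> /eqP e; rewrite e.
- by have -> : (d.+2 %% 4 = 1)%N by lia.
- by have -> : (d.+2 %% 4 = 2)%N by lia.
- by have -> : (d.+2 %% 4 = 3)%N by lia.
- by have -> : (d.+2 %% 4 = 0)%N by lia.
Qed.

(** Expanding sin(pi (d - u) / 2), the mixed term sin cos at u vanishes and the square of sin at u
    is the parity of u. *)
Lemma chi4_subn u d : (u <= d)%N -> chi4 u * chi4 (d - u) = - (cos4 d *+ odd u).
Proof.
move=> le_ud; have [j [r [eu ltr]]] := divn4_eq u; have [k [s [ed lts]]] := divn4_eq d.
have Eu : (u %% 4 = r)%N by lia.
have Ed : (d %% 4 = s)%N by lia.
have Em : ((d - u) %% 4 = (s + 4 - r) %% 4)%N by lia.
have -> : odd u = odd r by lia.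
rewrite !cos4E /chi4 Eu Ed Em; move: r s ltr lts {Eu Ed Em eu ed}.
by do 4?[case=> //]; do 4?[case=> //].
Qed.

Lemma sum_odd d : (0 < d)%N -> (\sum_(1 <= u < d) odd u = d./2)%N.
Proof.
case: d => // d _; elim: d => [|d IHd]; first by rewrite big_geq.
by rewrite big_nat_recr //= IHd; lia.
Qed.

Lemma sum_chi4_conv d : (0 < d)%N ->
  (\sum_(1 <= u < d) chi4 u * chi4 (d - u)) *+ 2 = - (cos4 d *+ d).
Proof.
move=> d_gt0; under eq_big_nat => u /andP[_ /ltnW le_ud] do rewrite chi4_subn //.
rewrite sumrN sumrMnr sum_odd // mulNrn -mulrnA muln2.
(* Twice [d./2] is d only for even d; for odd d the factor [cos4 d] is zero. *)
have [odd_d|even_d] := boolP (odd d); last by rewrite halfK (negPf even_d) subn0.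
have -> : cos4 d = 0 by rewrite /cos4; do 2!rewrite (_ : (_ %| _)%N = false); lia.
by rewrite !mul0rn.
Qed.

(** * The divisor formula *)

(** The multiplicities become the coefficients u = 2 r + 1, with chi4(u) = (-1)^r; solutions with an
    even coefficient contribute zero. *)
Lemma a_sols n : a n =
  \sum_(q <- sols n | (q.1.2 < q.2.2)%N) chi4 q.1.1 * chi4 q.2.1.
Proof.
have chi4_odd r : chi4 (2 * r + 1) = (-1) ^+ r.
  rewrite -signr_odd /chi4; case odd_r: (odd r) => /=.
    by rewrite (_ : ((2 * r + 1) %% 4 = 3)%N) //; lia.
  by rewrite (_ : ((2 * r + 1) %% 4 = 1)%N) //; lia.
have chi4_even u : ~~ odd u -> chi4 u = 0.
  by move=> u_even; rewrite /chi4 !ifF //; lia.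
rewrite /a pair_bigA /= pair_bigA /= pair_big_dep /=.
rewrite [RHS](bigID (fun q => odd q.1.1 && odd q.2.1)) /= [X in _ + X]big1 ?addr0.
  apply: (sum_seq_bij
    (h := fun t : 'I_n.+1 * 'I_n.+1 * 'I_n.+1 * 'I_n.+1 =>
      (2 * t.1.2 + 1, t.1.1.1 : nat, (2 * t.2 + 1, t.1.1.2 : nat))%N)
    (k := fun q => (inord q.1.2, inord q.2.2, inord q.1.1./2, inord q.2.1./2))).
  - exact: index_enum_uniq.
  - exact: sols_uniq.
  - move=> [[[x y] r] s] _ /= /and3P[x0 xy /eqP en]; rewrite mem_sols.
    split; [by rewrite en eqxx; lia | lia | | by rewrite !chi4_odd exprD].
    have halfE m : ((2 * m + 1)./2 = m)%N by lia.
    by rewrite !halfE !inord_val.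
  - move=> [[u x] [v y]]; rewrite mem_sols /= => /and5P[u0 x0 v0 y0 /eqP en].
    move=> /and3P[xy odd_u odd_v]; have le_x : (x <= n)%N by nia.
    have le_y : (y <= n)%N by nia.
    have le_u : (u./2 <= n)%N by nia.
    have le_v : (v./2 <= n)%N by nia.
    have eu : (2 * u./2 + 1 = u)%N by lia.
    have ev : (2 * v./2 + 1 = v)%N by lia.
    rewrite mem_index_enum /admissible /= !inordK // eu ev en eqxx xy x0.
    by split.
move=> q /andP[_]; rewrite negb_and.
by case/orP=> /chi4_even ->; rewrite ?mul0r ?mulr0.
Qed.

Lemma a_divisors n : (0 < n)%N ->
  a n *+ 4 = \sum_(d <- divisors n) ((n %/ d)%:R - chi4 d + cos4 d *+ (n %/ d) *+ 2).
Proof.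
move=> n_gt0.
(* Exchanging the two terms of the equation sends x < y to y < x and preserves the summand. *)
have two_a : a n *+ 2 = \sum_(q <- sols n) chi4 q.1.1 * chi4 q.2.1
    - \sum_(q <- sols n | q.1.2 == q.2.2) chi4 q.1.1 * chi4 q.2.1.
  rewrite (sols_trichotomy n (fun q => q.1.2) (fun q => q.2.2)) -a_sols /=.
  rewrite [X in _ = _ + (_ + X) - _]sols_swap /=.
  under [X in _ = _ + (_ + X) - _]eq_bigr => q _ do rewrite mulrC.
  by rewrite -a_sols; ring.
have -> : a n *+ 4 = a n *+ 2 *+ 2 by rewrite -mulrnA.
rewrite two_a mulrnBl (sols_sum_eq_factors n_gt0 (fun u v => chi4 u * chi4 v)).
rewrite -!sumrMnl; under eq_bigr => q _ do rewrite chi4M_cos4.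
rewrite Liouville_identity // -sumrB big_seq [RHS]big_seq.
apply: eq_bigr => d; rewrite -dvdn_divisors // => dn.
have d_gt0 := dvdn_gt0 n_gt0 dn.
rewrite sum_cos4 // sum_chi4_conv //.
have : (0 < n %/ d)%N by rewrite divn_gt0 // dvdn_leq.
(* Successor forms of n/d and d remove the predecessors; then the terms d cos4(d) from Liouville's
   identity and from the diagonal cancel. *)
case: (n %/ d)%N => // m _; case: d d_gt0 {dn} => // d _.
rewrite /= !mulrS (_ : cos4 0 = 1) //; ring.
Qed.

(** Complementation d -> n/d matches the multiples of k dividing n with the divisors of n/k. If k
    does not divide n, both sides are zero. All values of [sigma] thus become sums over
    [divisors n]. *)
Lemma sigma_divn (n k : nat) : (0 < n)%N -> (0 < k)%N ->
  sigma (n%:R / k%:R) = \sum_(d <- divisors n | (k %| d)%N) (n %/ d)%:R.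
Proof.
move=> n_gt0 k_gt0; have k0 : k%:R != 0 :> rat by rewrite pnatr_eq0 -lt0n.
have [kn|nkn] := boolP (k %| n)%N; last first.
  rewrite /sigma ifF; last first.
    apply: contraNF nkn => /natrP[m /(canRL (divfK k0))].
    by rewrite -natrM => /eqP; rewrite eqr_nat => /eqP->; apply: dvdn_mull.
  rewrite big_seq_cond big1 // => d; rewrite -dvdn_divisors // => /andP[dn kd].
  by rewrite (dvdn_trans kd dn) in nkn.
have -> : n%:R / k%:R = (n %/ k)%:R :> rat.
  by rewrite -[in LHS](divnK kn) natrM mulfK.
have nk_gt0 : (0 < n %/ k)%N by rewrite divn_gt0 // dvdn_leq.
have divnKn d : (d %| n)%N -> (n %/ (n %/ d) = d)%N by move=> dn; rewrite divnA // mulKn.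
rewrite sigma_nat; symmetry.
apply: (sum_seq_bij (h := fun d => (n %/ d)%N) (k := fun e => (n %/ e)%N));
  rewrite ?divisors_uniq // => d; rewrite -!dvdn_divisors //.
  move=> dn kd; rewrite divnKn //; split=> //.
  by rewrite dvdn_divRL // -[in X in (_ %| X)%N](divnK dn) dvdn_mul.
rewrite dvdn_divRL // => dkn _.
have dn : (d %| n)%N := dvdn_trans (dvdn_mulr _ (dvdnn _)) dkn.
split; first exact: dvdn_div.
  by rewrite dvdn_divRL ?(dvdn_gt0 n_gt0) // mulnC.
exact: divnKn.
Qed.

Theorem theorem1p1 (n : nat) (hn : (0 < n)%N) :
  (a n)%:~R = (sigma n%:R - (lambda n)%:~R) / 4%:R
              - sigma (n%:R / 2%:R) / 2%:R + sigma (n%:R / 4%:R) :> rat.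
Proof.
move: (a n) (a_divisors hn) => an /(congr1 (fun z : int => z%:~R : rat)).
have -> : sigma n%:R = sigma (n%:R / 1%:R) by rewrite divr1.
rewrite !sigma_divn //= /lambda.
have lambdaE : (\sum_(d <- divisors n) chi4 d)%:~R =
    \sum_(d <- divisors n) (chi4 d)%:~R :> rat by exact: rmorph_sum.
rewrite lambdaE rmorphMn /= rmorph_sum /= [X in _ -> _ = _ - X / _ + _]big_mkcond.
rewrite [X in _ -> _ = _ + X]big_mkcond /=.
under [X in _ -> _ = (X - _) / _ - _ + _]eq_bigl do rewrite dvd1n.
(* Twice [cos4 d] is 4 [4 | d] - 2 [2 | d]; division by 4 yields the coefficients 1 and -1/2 of the
   theorem. *)
have -> : \sum_(d <- divisors n)
      ((n %/ d)%:R - chi4 d + cos4 d *+ (n %/ d) *+ 2)%:~R =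
    \sum_(d <- divisors n) (n %/ d)%:R - \sum_(d <- divisors n) (chi4 d)%:~R
    - (\sum_(d <- divisors n) (if (2 %| d)%N then (n %/ d)%:R else 0)) *+ 2
    + (\sum_(d <- divisors n) (if (4 %| d)%N then (n %/ d)%:R else 0)) *+ 4 :> rat.
  rewrite -!sumrMnl -!sumrB -big_split /=; apply: eq_bigr => d _.
  have cos4R : (cos4 d)%:~R = (4 %| d)%N%:R * 2 - (2 %| d)%N%:R :> rat.
    by rewrite /cos4; case: (2 %| d)%N; case: (4 %| d)%N.
  rewrite rmorphD rmorphB !rmorphMn /= cos4R.
  rewrite -[_ *+ (n %/ d) *+ 2]mulrnAC -[_ *+ 2 *+ _]mulr_natr.
  move: ((n %/ d)%:R : rat) ((chi4 d)%:~R : rat) => m c.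
  by case: (2 %| d)%N; case: (4 %| d)%N => /=; ring.
lra.
Qed.
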